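(* Let $n\ge 1$, let $\alpha,\beta>0$, and let $\lambda_1,\dots,\lambda_n>0$ and $\lambda_1^*,\dots,\lambda_n^*>0$. Let $X_1,\dots,X_n$ be independent random variables with $X_i\sim \mathrm{ENH}(\alpha,\lambda_i,\beta)$, and let $X_1^*,\dots,X_n^*$ be independent random variables with $X_i^*\sim \mathrm{ENH}(\alpha,\lambda_i^*,\beta)$, $i=1,\dots,n$. Write $X_{n:n}=\max_i X_i$ and $X^*_{n:n}=\max_i X_i^*$. If $0<\alpha\le 1$ and $\lambda_i\le\lambda_i^*$ for every $i=1,\dots,n$, then $X_{n:n}\ge_{\mathrm{st}}X^*_{n:n}$.
   Context: For $\alpha,\lambda,\beta>0$, $X\sim \mathrm{ENH}(\alpha,\lambda,\beta)$ (exponentiated Nadarajah-Haghighi distribution) means that $X$ is a positive random variable with distribution function $[1-\exp\{1-(1+\lambda x)^{\alpha}\}]^{\beta}$ for $x>0$ (and $0$ for $x\le 0$). Usual stochastic order: $X\le_{\mathrm{st}}Y$ (equivalently $Y\ge_{\mathrm{st}}X$) means $P(X>x)\le P(Y>x)$ for all $x$. *)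

(* Defs.v *)
From HB Require Import structures.
From mathcomp Require Import all_boot all_order all_algebra.
From mathcomp Require Import all_classical all_reals all_analysis.
From mathcomp Require Import measurable_realfun.

Set Implicit Arguments.
Unset Strict Implicit.
Unset Printing Implicit Defensive.

Import Order.TTheory GRing.Theory Num.Theory.

Local Open Scope classical_set_scope.
Local Open Scope ring_scope.

Definition ENH_cdf (R : realType) (alpha lambda beta x : R) : R :=
  if 0 < x then (1 - expR (1 - (1 + lambda * x) `^ alpha)) `^ beta else 0.

(* Positivity of X is understood almost surely, and then it is contained in the
   condition on the distribution function, which gives P (X <= 0) = 0. *)
Definition is_ENH d (T : measurableType d) (R : realType)
    (P : probability T R) (X : {RV P >-> R}) (alpha lambda beta : R) : Prop :=
  forall x : R, cdf X x = (ENH_cdf alpha lambda beta x)%:E.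

(* Mutual independence: the product rule for every subfamily J of the finite
   index type and every choice of Borel sets. *)
Definition independent_RVs d (T : measurableType d) (R : realType)
    (P : probability T R) (I : finType) (X : I -> {RV P >-> R}) : Prop :=
  forall (J : {set I}) (B : I -> set R), (forall i, measurable (B i)) ->
    P (\bigcap_(i in [set` J]) X i @^-1` B i) =
    (\prod_(i in J) P (X i @^-1` B i))%E.

(* The two variables may live on different probability spaces. *)
Definition st_le d d' (T : measurableType d) (T' : measurableType d')
    (R : realType) (P : probability T R) (Q : probability T' R)
    (X : {RV P >-> R}) (Y : {RV Q >-> R}) : Prop :=
  forall x : R, (ccdf X x <= ccdf Y x)%E.

Arguments is_ENH {d T R} P X alpha lambda beta.
Arguments independent_RVs {d T R} P {I} X.
Arguments st_le {d d' T T' R} P Q X Y.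

Section max_RV.
Context d (T : measurableType d) (R : realType) (P : probability T R) (n : nat).
Variable X : 'I_n.+1 -> {RV P >-> R}.

(* The default value X ord0 w is itself one of the n.+1 values, so it does not
   affect the maximum. *)
Definition max_RV (w : T) : R := \big[Num.max/X ord0 w]_(i < n.+1) X i w.

Let measurable_max_RV : measurable_fun [set: T] max_RV.
Proof.
suff mmax (s : seq 'I_n.+1) :
    measurable_fun [set: T] (fun w => \big[Num.max/X ord0 w]_(i <- s) X i w).
  exact: mmax.
elim: s => [|i s IHs].
  under eq_fun do rewrite big_nil; exact: measurable_funPT.
under eq_fun do rewrite big_cons; exact: measurable_maxr.
Qed.

HB.instance Definition _ :=
  @isMeasurableFun.Build _ _ _ _ max_RV measurable_max_RV.

End max_RV.

(* Main.v *)
Require Import Defs.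
From mathcomp Require Import all_boot all_order all_algebra.
From mathcomp Require Import all_classical all_reals all_analysis.

(** The parameter [lambda] only rescales [x] in the ENH distribution function,
    which for positive [x] is nondecreasing in [lambda * x]; hence enlarging
    [lambda] enlarges the distribution function ([ENH_cdf_le]) and makes the
    variable stochastically smaller.  It remains to pass from the components to the
    maximum.  The event that the maximum is at most [x] is the intersection of
    the events that each component is at most [x], so by independence the
    distribution function of the maximum is the product of those of the
    components ([cdf_max_RV]).  A product of nonnegative factors is monotone in
    each factor, so the usual stochastic order between components is inherited
    by the maxima ([st_le_max_RV]), even when the two families live on different
    probability spaces. *)

Import Order.TTheory GRing.Theory Num.Theory.

Local Open Scope ring_scope.

Lemma st_le_cdf (d d' : measure_display)
    (T : measurableType d) (T' : measurableType d') (R : realType)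
    (P : probability T R) (Q : probability T' R)
    (X : {RV P >-> R}) (Y : {RV Q >-> R}) :
  st_le P Q X Y <-> forall x : R, (cdf Y x <= cdf X x)%E.
Proof.
split=> XY x; move: (XY x); first by rewrite !cdf_1_ccdf => ?; exact: leeB.
by rewrite !ccdf_1_cdf => ?; exact: leeB.
Qed.

Lemma lee_prod_ge0 (R : realDomainType) (I : Type) (r : seq I)
    (f g : I -> \bar R) :
  (forall i, (0 <= f i)%E) -> (forall i, (f i <= g i)%E) ->
  (\prod_(i <- r) f i <= \prod_(i <- r) g i)%E.
Proof.
move=> f0 fg; elim: r => [|i r IHr]; first by rewrite !big_nil.
by rewrite !big_cons lee_pmul ?prode_ge0.
Qed.

(** This is the independence product rule for the Borel sets [`]-oo, x]],
    because the maximum is at most [x] exactly when every component is. *)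
Lemma cdf_max_RV (d : measure_display) (T : measurableType d) (R : realType)
    (P : probability T R) (n : nat) (X : 'I_n.+1 -> {RV P >-> R}) (x : R) :
  independent_RVs P X -> cdf (P := P) (max_RV X) x =
  (\prod_i cdf (X i) x)%E.
Proof.
move=> indepX; rewrite /cdf /distribution /pushforward.
have := indepX [set: 'I_n.+1]%SET (fun=> `]-oo, x]%classic)
  (fun=> measurable_itv _).
under eq_bigl do rewrite inE.
move=> <-; congr (P _); apply/seteqP; split=> w /=.
- by rewrite in_itv/= => /bigmax_leP[_ Xx] i _ /=; rewrite in_itv/= Xx.
- move=> Xx; rewrite in_itv/=; apply/bigmax_leP.
  have {}Xx i : X i w <= x by have := Xx i (finset.in_setT i); rewrite /= in_itv.
  by split=> [|i _]; exact: Xx.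
Qed.

Lemma st_le_max_RV (d d' : measure_display)
    (T : measurableType d) (T' : measurableType d') (R : realType)
    (P : probability T R) (Q : probability T' R) (n : nat)
    (X : 'I_n.+1 -> {RV P >-> R}) (Y : 'I_n.+1 -> {RV Q >-> R}) :
  independent_RVs P X -> independent_RVs Q Y ->
  (forall i, st_le P Q (X i) (Y i)) -> st_le P Q (max_RV X) (max_RV Y).
Proof.
move=> indepX indepY XY; apply/st_le_cdf => x; rewrite !cdf_max_RV//.
by apply: lee_prod_ge0 => i; [exact: cdf_ge0 | by have /st_le_cdf := XY i].
Qed.

Lemma powR_homo (R : realType) (r a b : R) :
  0 <= r -> 0 <= a -> a <= b -> a `^ r <= b `^ r.
Proof.
move=> r0 a0 ab; apply: (ge0_ler_powR r0); rewrite ?nnegrE//.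
exact: le_trans ab.
Qed.

Lemma ENH_cdf_le (R : realType) (alpha beta l l' x : R) :
  0 <= alpha -> 0 <= beta -> 0 <= l -> l <= l' ->
  ENH_cdf alpha l beta x <= ENH_cdf alpha l' beta x.
Proof.
move=> alpha0 beta0 l0 ll'; rewrite /ENH_cdf.
case: (boolP (0 < x)) => [x0|_]; last exact: lexx.
have le1 (k : R) : 0 <= k -> 1 <= 1 + k * x.
  by move=> k0; rewrite lerDl mulr_ge0// ltW.
have le1_powR (k : R) : 0 <= k -> 1 <= (1 + k * x) `^ alpha.
  move=> k0; have := powR_homo _ _ _ _ alpha0 ler01 (le1 k k0).
  by rewrite powR1.
(* [powR] is monotone in its base only on nonnegative bases; the base of the
   outer power is nonnegative because the exponential has a nonpositive
   argument. *)
have base_ge0 : 0 <= 1 - expR (1 - (1 + l * x) `^ alpha).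
  by rewrite subr_ge0 -[leRHS]expR0 ler_expR subr_le0 le1_powR.
apply: powR_homo; [exact: beta0 | exact: base_ge0 | ].
rewrite lerD2l lerN2 ler_expR lerD2l lerN2.
apply: powR_homo; [exact: alpha0 | exact: le_trans ler01 (le1 _ l0) | ].
by rewrite lerD2l; apply: ler_wpM2r => //; exact: ltW.
Qed.

Theorem theorem3p5 (R : realType) (d d' : measure_display)
    (T : measurableType d) (T' : measurableType d')
    (P : probability T R) (P' : probability T' R)
    (n : nat) (alpha beta : R) (lambda lambda' : 'I_n.+1 -> R)
    (X : 'I_n.+1 -> {RV P >-> R}) (X' : 'I_n.+1 -> {RV P' >-> R})
    (alpha_gt0 : 0 < alpha) (beta_gt0 : 0 < beta)
    (lambda_gt0 : forall i, 0 < lambda i)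
    (lambda'_gt0 : forall i, 0 < lambda' i)
    (indepX : independent_RVs P X) (indepX' : independent_RVs P' X')
    (enhX : forall i, is_ENH P (X i) alpha (lambda i) beta)
    (enhX' : forall i, is_ENH P' (X' i) alpha (lambda' i) beta)
    (alpha_le1 : alpha <= 1)
    (le_lambda : forall i, lambda i <= lambda' i) :
  st_le P' P (max_RV X') (max_RV X).
Proof.
apply: st_le_max_RV => // i; apply/st_le_cdf => x.
by rewrite enhX enhX' lee_fin ENH_cdf_le// ltW.
Qed.
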